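(* Let $A$ be a Banach algebra with a BAI. Left version. Assume that for every $\mu \in LM(A)$ there is a closed subalgebra $B$ of $A$ which satisfies condition $(L)$ (defined in the context) and is such that (1) for each $f \in A^*A$, $f|_B \in B^*B$; (2) $\mu(B)\subseteq B$, and $\mu\in A$ if $\mu|_B\in B$. Then for all $\mu\in LM(A)$ the following are equivalent: (i) $\mu\in A$; (ii) there is $m\in A^{**}$ such that $\mu^{**}(n) = m\cdot n$ for all $n\in A^{**}$; (iii) $\mu^*(A^* )\subseteq \langle A^*A\rangle$. Right version. Assume that for every $\mu \in RM(A)$ there is a closed subalgebra $B$ of $A$ which satisfies condition $(R)$ (defined in the context) and is such that (1) for each $f \in AA^*$, $f|_B \in BB^*$; (2) $\mu(B)\subseteq B$, and $\mu\in A$ if $\mu|_B\in B$. Then for all $\mu\in RM(A)$ the following are equivalent: (i) $\mu\in A$; (ii) there is $m\in A^{**}$ such that $\mu^{**}(n) = n\bigtriangleup m$ for all $n\in A^{**}$; (iii) $\mu^*(A^* )\subseteq \langle AA^*\rangle$.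
   Context: For a Banach algebra $A$: BAI means bounded (two-sided) approximate identity; a sequential approximate identity is a (two-sided, not necessarily bounded) approximate identity that is a sequence. $A$ is WSC if it is weakly sequentially complete. $LM(A)=\{T\in B(A): T(ab)=T(a)b \ \forall a,b\}$, $RM(A)=\{T\in B(A): T(ab)=aT(b)\ \forall a,b\}$. $l_a(b)=ab$, $r_a(b)=ba$. For $\mu\in LM(A)$ (resp. $\mu\in RM(A)$), ''$\mu\in A$'' means $\mu = l_a$ (resp. $\mu = r_a$) for some $a\in A$; likewise, for a closed subalgebra $C$ of $A$ with $\mu(C)\subseteq C$, ''$\mu|_C\in C$'' means $\mu|_C$ is of the form $x\mapsto cx$ (resp. $x\mapsto xc$) on $C$ for some $c\in C$. $A^*$ is an $A$-bimodule via $\langle f\cdot a,b\rangle=\langle f,ab\rangle$, $\langle a\cdot f,b\rangle=\langle f,ba\rangle$. $A^*A=\{f\cdot a: f\in A^*, a\in A\}$, $AA^*=\{a\cdot f\}$, and $\langle A^*A\rangle$, $\langle AA^*\rangle$ are their closed linear spans in $A^*$. The left Arens product on $A^{**}$: $\langle m\cdot n,f\rangle=\langle m,n\cdot f\rangle$, $\langle n\cdot f,a\rangle=\langle n,f\cdot a\rangle$. The right Arens product: $\langle m\bigtriangleup n,f\rangle=\langle n,f\bigtriangleup m\rangle$, $\langle f\bigtriangleup m,a\rangle=\langle m,a\cdot f\rangle$. Condition $(L)$ for a Banach algebra $B$: $B$ has a BAI and there is a family $\{B_i\}_{i\in\Lambda}$ of closed left ideals in $B$ such that (I) each $B_i$ is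 WSC with a sequential approximate identity; (II) for each $i$ there is a linear projection $p_i$ from $B$ onto $B_i$ which is a right $B_i$-module map ($p_i(xy)=p_i(x)y$ for $x\in B$, $y\in B_i$); (III) for any $\nu\in LM(B)$, if $\nu|_{B_i}\in B_i$ for all $i\in\Lambda$, then $\nu\in B$. Condition $(R)$ for a Banach algebra $B$: $B$ has a BAI and there is a family $\{B_i\}_{i\in\Lambda}$ of closed right ideals in $B$ such that (I) each $B_i$ is WSC with a sequential approximate identity; (II) for each $i$ there is a linear projection $p_i$ from $B$ onto $B_i$ which is a left $B_i$-module map ($p_i(yx)=yp_i(x)$ for $x\in B$, $y\in B_i$); (III) for any $\nu\in RM(B)$, if $\nu|_{B_i}\in B_i$ for all $i\in\Lambda$, then $\nu\in B$. (Since $B$ has a BAI, $\nu(B_i)\subseteq B_i$ holds in (III).) *)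

(* Defs.v *)
From HB Require Import structures.
From mathcomp Require Import all_boot all_order all_algebra.
From mathcomp Require Import complex.
From mathcomp Require Import boolp classical_sets functions reals topology.
From mathcomp Require Import normedtype.
Set Implicit Arguments.
Unset Strict Implicit.
Unset Printing Implicit Defensive.
Import Order.TTheory GRing.Theory Num.Theory.
Import numFieldNormedType.Exports.
Local Open Scope classical_set_scope.
Local Open Scope ring_scope.

(* Both scalar fields are covered: [scalars R true] is the complex field over
   [R] and [scalars R false] is [R] itself. *)
Definition scalars (R : realType) (c : bool) : numFieldType :=
  if c then (R[i] : numFieldType) else (R : numFieldType).

Section Scalars.
Variable R : realType.

Definition sc_of (c : bool) : R -> scalars R c :=
  match c with true => fun r => r%:C%C | false => id end.

Definition sc_re (c : bool) : scalars R c -> R :=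
  match c with true => @complex.Re R | false => id end.

Lemma sc_of_le c (r s : R) : (sc_of c r <= sc_of c s) = (r <= s).
Proof. by case: c => //=; rewrite lecR. Qed.

Lemma sc_ofK c : cancel (@sc_of c) (@sc_re c).
Proof. by case: c. Qed.

Lemma sc_ofD c (r s : R) : sc_of c (r + s) = sc_of c r + sc_of c s.
Proof. by case: c => //=; rewrite rmorphD. Qed.

Lemma sc_ofM c (r s : R) : sc_of c (r * s) = sc_of c r * sc_of c s.
Proof. by case: c => //=; rewrite rmorphM. Qed.

Lemma sc_of0 c : sc_of c 0 = 0.
Proof. by case: c => //=. Qed.

Lemma sc_of1 c : sc_of c 1 = 1.
Proof. by case: c => //=. Qed.

Lemma sc_reK c (k : scalars R c) : 0 <= k -> sc_of c (sc_re k) = k.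
Proof.
case: c k => //= -[a b]; rewrite lecE /= => /andP[/eqP -> _].
by [].
Qed.

End Scalars.

Section Blin.
Variables (K : numFieldType) (X Y : normedModType K).

Definition bounded_linear : {pred X -> Y} :=
  mem [set f : X -> Y | linear f /\ continuous f].

Record blin : Type := Blin { blin_fun :> X -> Y ; blinP : blin_fun \in bounded_linear }.

HB.instance Definition _ := [isSub for blin_fun].
HB.instance Definition _ := [Choice of blin by <:].

Lemma bounded_linear_submod_closed : submod_closed bounded_linear.
Proof.
split.
  apply/mem_set; split=> [a u v|x].
    by change (0 = a *: 0 + 0 :> Y); rewrite scaler0 addr0.
  exact: (@cst_continuous X Y 0).
move=> a f g /set_mem[lf cf] /set_mem[lg cg]; apply/mem_set; split.
  move=> b u v; change (a *: f (b *: u + v) + g (b *: u + v) =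
    b *: (a *: f u + g u) + (a *: f v + g v)).
  by rewrite lf lg !scalerDr !scalerA addrACA (mulrC a b).
by move=> x; apply: cvgD; [apply: cvgZr; exact: cf|exact: cg].
Qed.

HB.instance Definition _ :=
  GRing.isSubmodClosed.Build K (X -> Y) bounded_linear
    bounded_linear_submod_closed.
HB.instance Definition _ := [SubChoice_isSubLmodule of blin by <:].

Lemma blin_linear (f : blin) : linear f.
Proof. by have /set_mem[] := blinP f. Qed.

HB.instance Definition _ (f : blin) :=
  GRing.isLinear.Build K X Y *:%R (blin_fun f) (blin_linear f).

Lemma blin_continuous (f : blin) : continuous f.
Proof. by have /set_mem[] := blinP f. Qed.

Lemma blinDE (f g : blin) x : (f + g) x = f x + g x. Proof. by []. Qed.
Lemma blinZE a (f : blin) x : (a *: f) x = a *: f x. Proof. by []. Qed.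
Lemma blin0E x : (0 : blin) x = 0. Proof. by []. Qed.

Lemma blin_ext (f g : blin) : f =1 g -> f = g.
Proof. by move=> fg; apply/val_inj/funext. Qed.

Lemma blin_bounded (f : blin) : exists2 M, 0 <= M & forall x, `|f x| <= M * `|x|.
Proof.
have /linear_boundedP := @continuous_linear_bounded _ _ _ 0 f (@blin_continuous f 0).
case/pinfty_ex_gt0 => M M0 H; exists M => //; exact: ltW.
Qed.

Lemma bounded_linearP (f : X -> Y) : linear f ->
  (exists2 M, 0 <= M & forall x, `|f x| <= M * `|x|) -> f \in bounded_linear.
Proof.
move=> lf [M M0 fM]; apply/mem_set; split=> //.
pose F := HB.pack_for {linear X -> Y} f (GRing.isLinear.Build K X Y *:%R f lf).
apply: (@bounded_linear_continuous _ _ _ F); apply/linear_boundedP.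
near=> r => x; rewrite (le_trans (fM x))// ler_wpM2r//.
by near: r; apply: nbhs_pinfty_ge; exact: ger0_real.
Unshelve. all: by end_near. Qed.

End Blin.

Definition mk_blin (K : numFieldType) (X Y : normedModType K) (f : X -> Y)
    (lf : linear f) (bf : exists2 M, 0 <= M & forall x, `|f x| <= M * `|x|) :
  blin X Y := Blin (bounded_linearP lf bf).

Section Composition.
Variables (K : numFieldType) (X Y Z : normedModType K).
Variables (g : blin Y Z) (f : blin X Y).

Let comp_linear : linear (g \o f).
Proof. by move=> k x y /=; rewrite !linearP. Qed.

Let comp_bounded : exists2 M, 0 <= M & forall x, `|(g \o f) x| <= M * `|x|.
Proof.
have [M M0 gM] := blin_bounded g; have [N N0 fN] := blin_bounded f.
exists (M * N) => [|x /=]; first exact: mulr_ge0.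
by rewrite (le_trans (gM _))// -mulrA ler_wpM2l.
Qed.

Definition comp_blin : blin X Z := mk_blin comp_linear comp_bounded.

End Composition.

Section OperatorNorm.
Variables (R : realType) (c : bool).
Local Notation K := (scalars R c).
Variables X Y : normedModType K.
Implicit Types (f g : blin X Y) (M : K).

(* Norms take their values in the scalar field, so the supremum is computed in
   [R] and injected back. *)
Definition opnorm f : K :=
  sc_of c (sup [set sc_re `|f x| | x in [set x : X | `|x| <= 1]]).

Let sc_reL (k l : K) : 0 <= k -> 0 <= l -> k <= l -> sc_re k <= sc_re l.
Proof. by move=> k0 l0; rewrite -(sc_of_le c) !sc_reK. Qed.

Let sup_opnorm f :
  has_sup [set sc_re `|f x| | x in [set x : X | `|x| <= 1]].
Proof.
split; first by exists (sc_re `|f 0|), 0 => //=; rewrite normr0.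
have [M M0 fM] := blin_bounded f.
exists (sc_re M) => _ [x /= x1 <-]; apply: sc_reL => //.
by rewrite (le_trans (fM x))// ler_piMr.
Qed.

Lemma opnorm_ge0 f : 0 <= opnorm f.
Proof.
rewrite -(sc_of0 R c) sc_of_le; apply: (@le_trans _ _ (sc_re `|f 0|)).
  by rewrite -(sc_of_le c) sc_reK// sc_of0.
by apply: sup_upper_bound => //; exists 0 => //=; rewrite normr0.
Qed.

Lemma le_opnorm f x : `|f x| <= opnorm f * `|x|.
Proof.
have [->|x0] := eqVneq x 0; first by rewrite linear0 !normr0 mulr0.
have nx0 : 0 < `|x| by rewrite normr_gt0.
rewrite -ler_pdivrMr// mulrC.
have -> : `|x|^-1 * `|f x| = `|f (`|x|^-1 *: x)|.
  by rewrite linearZ normrZ ger0_norm// invr_ge0.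
rewrite -[leLHS](@sc_reK R c)// sc_of_le; apply: sup_upper_bound => //.
by exists (`|x|^-1 *: x) => //=; rewrite normrZ ger0_norm ?invr_ge0// mulVf ?gt_eqF.
Qed.

Lemma opnorm_le f M : 0 <= M -> (forall x, `|f x| <= M * `|x|) -> opnorm f <= M.
Proof.
move=> M0 fM; rewrite -(@sc_reK R c M)// sc_of_le; apply: ge_sup.
  by have [] := sup_opnorm f.
move=> _ [x /= x1 <-]; apply: sc_reL => //.
by rewrite (le_trans (fM x))// ler_piMr.
Qed.

Lemma opnormD f g : opnorm (f + g) <= opnorm f + opnorm g.
Proof.
apply: opnorm_le => [|x]; first by rewrite addr_ge0 ?opnorm_ge0.
by rewrite blinDE mulrDl (le_trans (ler_normD _ _))// lerD ?le_opnorm.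
Qed.

Let opnormZ_le a f : opnorm (a *: f) <= `|a| * opnorm f.
Proof.
apply: opnorm_le => [|x]; first by rewrite mulr_ge0 ?opnorm_ge0.
by rewrite blinZE normrZ -mulrA ler_wpM2l// le_opnorm.
Qed.

Lemma opnormZ a f : opnorm (a *: f) = `|a| * opnorm f.
Proof.
apply/eqP; rewrite eq_le opnormZ_le /=.
have [->|a0] := eqVneq a 0; first by rewrite normr0 mul0r opnorm_ge0.
rewrite -ler_pdivlMl ?normr_gt0// -normfV.
by rewrite -[in leLHS](scale1r f) -(mulVf a0) -scalerA opnormZ_le.
Qed.

Lemma opnorm0_eq0 f : opnorm f = 0 -> f = 0.
Proof.
move=> f0; apply: blin_ext => x; apply/normr0_eq0/eqP.
by rewrite eq_le normr_ge0 andbT (le_trans (le_opnorm f x))// f0 mul0r.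
Qed.

HB.instance Definition _ := @Lmodule_isNormed.Build K (blin X Y)
  opnorm opnormD opnormZ opnorm0_eq0.

Lemma opnormE f : `|f| = opnorm f. Proof. by []. Qed.

Lemma le_blin_norm f x : `|f x| <= `|f| * `|x|.
Proof. exact: le_opnorm. Qed.

End OperatorNorm.

Notation dual X := (blin X (_ ^o)).

Section Adjoint.
Variables (R : realType) (c : bool).
Local Notation K := (scalars R c).
Variables X Y : normedModType K.

Lemma comp_opnorm (Z : normedModType K) (g : blin Y Z) (f : blin X Y) :
  `|comp_blin g f| <= `|g| * `|f|.
Proof.
apply: opnorm_le => [|x]; first exact: mulr_ge0.
rewrite (le_trans (le_blin_norm g (f x)))// -mulrA ler_wpM2l//.
exact: le_blin_norm.
Qed.

Variable T : blin X Y.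

Let adjoint_fun (f : dual Y) : dual X := comp_blin f T.

Let adjoint_linear : linear adjoint_fun.
Proof. by move=> k f g; apply: blin_ext. Qed.

Let adjoint_bounded :
  exists2 M, 0 <= M & forall f, `|adjoint_fun f| <= M * `|f|.
Proof. by exists `|T| => // f; rewrite mulrC comp_opnorm. Qed.

Definition adjoint : blin (dual Y) (dual X) :=
  mk_blin adjoint_linear adjoint_bounded.

End Adjoint.

Definition weakly_sequentially_complete (K : numFieldType)
    (X : normedModType K) : Prop :=
  forall x : nat -> X,
    (forall f : dual X, cauchy (f (x n) @[n --> \oo])) ->
    exists y : X, forall f : dual X, f (x n) @[n --> \oo] --> f y.

Definition closed_span (K : numFieldType) (X : normedModType K) (S : set X) :
    set X :=
  closure [set x | exists (n : nat) (k : 'I_n -> K) (s : 'I_n -> X),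
    (forall i, S (s i)) /\ x = \sum_(i < n) k i *: s i].

Reserved Notation "x *b y" (at level 40, left associativity).

(* The library's algebras are unital, Banach algebras need not be. *)
HB.mixin Record CompleteNormedModule_isBanachAlg (K : numFieldType) A
    & CompleteNormedModule K A := {
  bmul : A -> A -> A ;
  bmulA : associative bmul ;
  bmulDl : left_distributive bmul +%R ;
  bmulDr : right_distributive bmul +%R ;
  bmulZl : forall (k : K) x y, bmul (k *: x) y = k *: bmul x y ;
  bmulZr : forall (k : K) x y, bmul x (k *: y) = k *: bmul x y ;
  ler_norm_bmul : forall x y, `|bmul x y| <= `|x| * `|y|
}.

#[short(type="banachAlgType")]
HB.structure Definition BanachAlg (K : numFieldType) :=
  {A of CompleteNormedModule K A & CompleteNormedModule_isBanachAlg K A}.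

Notation "x *b y" := (bmul x y) : ring_scope.

Record closedSubalg (K : numFieldType) (A : banachAlgType K) := ClosedSubalg {
  subalg_set :> A -> Prop ;
  subalg_closed : closed (subalg_set : set A) ;
  subalg0 : subalg_set 0 ;
  subalgD : forall x y, subalg_set x -> subalg_set y -> subalg_set (x + y) ;
  subalgZ : forall (k : K) x, subalg_set x -> subalg_set (k *: x) ;
  subalgM : forall x y, subalg_set x -> subalg_set y -> subalg_set (x *b y)
}.

(* A closed subalgebra is a Banach algebra in its own right, for the operations
   and the norm of the ambient algebra. *)
Section Subalgebra.
Variables (K : numFieldType) (A : banachAlgType K) (B : closedSubalg A).

Definition subalg_pred : {pred A} := mem (subalg_set B : set A).

Record subalg : Type := Subalg { subalg_val :> A ; subalg_valP : subalg_val \in subalg_pred }.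

HB.instance Definition _ := [isSub for subalg_val].
HB.instance Definition _ := [Choice of subalg by <:].

Lemma subalg_submod_closed : submod_closed subalg_pred.
Proof.
split; first exact/mem_set/subalg0.
move=> k x y /set_mem Bx /set_mem By; apply/mem_set/subalgD => //.
exact: subalgZ.
Qed.

HB.instance Definition _ :=
  GRing.isSubmodClosed.Build K A subalg_pred subalg_submod_closed.
HB.instance Definition _ := [SubChoice_isSubLmodule of subalg by <:].

Lemma subalgP (x : subalg) : B (x : A).
Proof. exact/set_mem/subalg_valP. Qed.

Definition subalg_norm (x : subalg) : K := `|x : A|.

Let subalg_normD x y : subalg_norm (x + y) <= subalg_norm x + subalg_norm y.
Proof. exact: ler_normD. Qed.

Let subalg_normZ (k : K) x : subalg_norm (k *: x) = `|k| * subalg_norm x.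
Proof. exact: normrZ. Qed.

Let subalg_norm0_eq0 x : subalg_norm x = 0 -> x = 0.
Proof. by move=> x0; apply/val_inj/normr0_eq0. Qed.

HB.instance Definition _ := @Lmodule_isNormed.Build K subalg
  subalg_norm subalg_normD subalg_normZ subalg_norm0_eq0.

Let subalg_complete (F : set_system subalg) :
  ProperFilter F -> cauchy F -> cvg F.
Proof.
move=> PF cF.
have cG : cauchy (subalg_val @ F).
  apply/cauchy_ballP => e e0; move/cauchy_ballP : cF => /(_ _ e0).
  move=> -[[P Q] /= [FP FQ] PQ].
  exists (subalg_val @` P, subalg_val @` Q) => /=.
    by split; [apply: filterS FP|apply: filterS FQ] => x Px; exists x.
  by move=> [_ _] /= [[x Px <-] [y Qy <-]]; have := PQ (x, y) (conj Px Qy); rewrite -!ball_normE.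
have : cvg (subalg_val @ F) by apply: cauchy_cvg.
set a := lim (subalg_val @ F) => Fa.
have Ba : B a.
  apply: (@closed_cvg _ _ F _ subalg_val _ (@subalg_closed _ _ B) _ _ Fa).
  by apply: nearW => x; exact: subalgP.
apply: (@cvgP _ F (Subalg (mem_set Ba))); apply/fcvg_ballP => e e0.
by move/fcvg_ballP : Fa => /(_ _ e0); rewrite -!ball_normE.
Qed.

HB.instance Definition _ := @Uniform_isComplete.Build subalg subalg_complete.

Definition subalg_mul (x y : subalg) : subalg :=
  Subalg (mem_set (subalgM (subalgP x) (subalgP y))).

Let subalg_mulA : associative subalg_mul.
Proof. by move=> x y z; apply/val_inj/bmulA. Qed.
Let subalg_mulDl : left_distributive subalg_mul +%R.
Proof. by move=> x y z; apply/val_inj/bmulDl. Qed.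
Let subalg_mulDr : right_distributive subalg_mul +%R.
Proof. by move=> x y z; apply/val_inj/bmulDr. Qed.
Let subalg_mulZl (k : K) x y : subalg_mul (k *: x) y = k *: subalg_mul x y.
Proof. exact/val_inj/bmulZl. Qed.
Let subalg_mulZr (k : K) x y : subalg_mul x (k *: y) = k *: subalg_mul x y.
Proof. exact/val_inj/bmulZr. Qed.
Let ler_norm_subalg_mul (x y : subalg) : `|subalg_mul x y| <= `|x| * `|y|.
Proof. exact: ler_norm_bmul. Qed.

HB.instance Definition _ := @CompleteNormedModule_isBanachAlg.Build K subalg
  subalg_mul subalg_mulA subalg_mulDl subalg_mulDr subalg_mulZl subalg_mulZr
  ler_norm_subalg_mul.

End Subalgebra.

Section Multiplication.
Variables (K : numFieldType) (A : banachAlgType K) (a : A).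

Let lmul_linear : linear (fun b : A => a *b b).
Proof. by move=> k x y; rewrite bmulDr bmulZr. Qed.

Let lmul_bounded : exists2 M, 0 <= M & forall b : A, `|a *b b| <= M * `|b|.
Proof. by exists `|a| => // b; exact: ler_norm_bmul. Qed.

Let rmul_linear : linear (fun b : A => b *b a).
Proof. by move=> k x y; rewrite bmulDl bmulZl. Qed.

Let rmul_bounded : exists2 M, 0 <= M & forall b : A, `|b *b a| <= M * `|b|.
Proof. by exists `|a| => // b; rewrite mulrC; exact: ler_norm_bmul. Qed.

Definition lmul : blin A A := mk_blin lmul_linear lmul_bounded.
Definition rmul : blin A A := mk_blin rmul_linear rmul_bounded.

End Multiplication.

Section Restriction.
Variables (K : numFieldType) (A : banachAlgType K) (B : closedSubalg A).

Let subalg_val_linear : linear (@subalg_val K A B).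
Proof. by []. Qed.

Let subalg_val_bounded :
  exists2 M : K, 0 <= M & forall x : subalg B, `|x : A| <= M * `|x|.
Proof. by exists 1 => // x; rewrite mul1r. Qed.

Definition incl : blin (subalg B) A := mk_blin subalg_val_linear subalg_val_bounded.

Definition dual_restr (f : dual A) : dual (subalg B) := comp_blin f incl.

End Restriction.

Section Approximate.
Variables (K : numFieldType) (A : banachAlgType K).

Definition directed (I : Type) (le : I -> I -> Prop) : Prop :=
  [/\ inhabited I, forall i, le i i,
      forall i j k, le i j -> le j k -> le i k
    & forall i j, exists2 k, le i k & le j k].

(* A net converges when it does so along the filter of the tails of its index. *)
Definition tails (I : Type) (le : I -> I -> Prop) : set_system I :=
  filter_from setT (fun i => [set j | le i j]).

Definition has_BAI : Prop :=
  exists (I : Type) (le : I -> I -> Prop) (e : I -> A),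
  [/\ directed le,
      exists M : K, forall i, `|e i| <= M
    & forall a : A, e i *b a @[i --> tails le] --> a /\
                    a *b e i @[i --> tails le] --> a].

Definition has_seq_approx_id : Prop :=
  exists e : nat -> A, forall a : A,
    e n *b a @[n --> \oo] --> a /\ a *b e n @[n --> \oo] --> a.

End Approximate.

Section Multipliers.
Variables (K : numFieldType) (A : banachAlgType K).
Implicit Type mu : blin A A.

Definition LM mu : Prop := forall a b, mu (a *b b) = mu a *b b.
Definition RM mu : Prop := forall a b, mu (a *b b) = a *b mu b.

(* Membership of a multiplier, or of its restriction to C, in the algebra A,
   resp. C. *)
Definition is_lmul mu : Prop := exists a, mu = lmul a.
Definition is_rmul mu : Prop := exists a, mu = rmul a.

Definition is_lmul_on (C : closedSubalg A) mu : Prop :=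
  exists2 a, C a & forall x, C x -> mu x = a *b x.
Definition is_rmul_on (C : closedSubalg A) mu : Prop :=
  exists2 a, C a & forall x, C x -> mu x = x *b a.

(* A closed left or right ideal is a closed subalgebra with the following
   absorption property. *)
Definition left_ideal (C : closedSubalg A) : Prop :=
  forall x y, C y -> C (x *b y).
Definition right_ideal (C : closedSubalg A) : Prop :=
  forall x y, C y -> C (y *b x).

(* Boundedness of the projection is not required. *)
Definition projection_onto (C : closedSubalg A) (p : {linear A -> A}) : Prop :=
  (forall x, C (p x)) /\ (forall x, C x -> p x = x).

Definition condition_L : Prop :=
  has_BAI A /\
  exists (I : Type) (C : I -> closedSubalg A),
  [/\ forall i, left_ideal (C i),
      forall i, weakly_sequentially_complete (subalg (C i)) /\
                has_seq_approx_id (subalg (C i)),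
      forall i, exists p : {linear A -> A}, projection_onto (C i) p /\
                forall x y, C i y -> p (x *b y) = p x *b y
    & forall nu, LM nu -> (forall i, is_lmul_on (C i) nu) -> is_lmul nu].

Definition condition_R : Prop :=
  has_BAI A /\
  exists (I : Type) (C : I -> closedSubalg A),
  [/\ forall i, right_ideal (C i),
      forall i, weakly_sequentially_complete (subalg (C i)) /\
                has_seq_approx_id (subalg (C i)),
      forall i, exists p : {linear A -> A}, projection_onto (C i) p /\
                forall x y, C i y -> p (y *b x) = y *b p x
    & forall nu, RM nu -> (forall i, is_rmul_on (C i) nu) -> is_rmul nu].

(* <f . a, b> = <f, ab>  and  <a . f, b> = <f, ba> *)
Definition dualr (f : dual A) (a : A) : dual A := comp_blin f (lmul a).
Definition duall (a : A) (f : dual A) : dual A := comp_blin f (rmul a).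

Definition dualr_set : set (dual A) := [set h | exists f a, h = dualr f a].
Definition duall_set : set (dual A) := [set h | exists a f, h = duall a f].

End Multipliers.

Arguments dualr_set {K} A.
Arguments duall_set {K} A.

Section Arens.
Variables (R : realType) (c : bool) (A : banachAlgType (scalars R c)).
Local Notation K := (scalars R c).
Implicit Types (f : dual A) (m n : dual (dual A)).

Lemma lmul_opnorm (a : A) : `|lmul a| <= `|a|.
Proof. by apply: opnorm_le => // b; exact: ler_norm_bmul. Qed.

Lemma rmul_opnorm (a : A) : `|rmul a| <= `|a|.
Proof. by apply: opnorm_le => // b; rewrite mulrC; exact: ler_norm_bmul. Qed.

Lemma dualr_norm f (a : A) : `|dualr f a| <= `|f| * `|a|.
Proof. by rewrite (le_trans (comp_opnorm _ _))// ler_wpM2l// lmul_opnorm. Qed.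

Lemma duall_norm f (a : A) : `|duall a f| <= `|f| * `|a|.
Proof. by rewrite (le_trans (comp_opnorm _ _))// ler_wpM2l// rmul_opnorm. Qed.

Section Act.
Variables (n : dual (dual A)) (f : dual A).

Let larens_act_linear : linear (fun a : A => n (dualr f a) : K^o).
Proof.
move=> k a b; apply: etrans (linearP n k (dualr f a) (dualr f b)).
congr (n _); apply: blin_ext => x.
by rewrite [RHS](esym (linearP f k _ _)) /= bmulDl bmulZl.
Qed.

Let larens_act_bounded :
  exists2 M, 0 <= M & forall a : A, `|n (dualr f a) : K^o| <= M * `|a|.
Proof.
exists (`|n| * `|f|) => [|a]; first exact: mulr_ge0.
by rewrite (le_trans (le_blin_norm _ _))// -mulrA ler_wpM2l// dualr_norm.
Qed.

(* <n . f, a> = <n, f . a> *)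
Definition larens_act : dual A := mk_blin larens_act_linear larens_act_bounded.

Let rarens_act_linear : linear (fun a : A => n (duall a f) : K^o).
Proof.
move=> k a b; apply: etrans (linearP n k (duall a f) (duall b f)).
congr (n _); apply: blin_ext => x.
by rewrite [RHS](esym (linearP f k _ _)) /= bmulDr bmulZr.
Qed.

Let rarens_act_bounded :
  exists2 M, 0 <= M & forall a : A, `|n (duall a f) : K^o| <= M * `|a|.
Proof.
exists (`|n| * `|f|) => [|a]; first exact: mulr_ge0.
by rewrite (le_trans (le_blin_norm _ _))// -mulrA ler_wpM2l// duall_norm.
Qed.

(* <f # n, a> = <n, a . f>, with # the right Arens product *)
Definition rarens_act : dual A := mk_blin rarens_act_linear rarens_act_bounded.

End Act.

Lemma larens_act_norm n f : `|larens_act n f| <= `|n| * `|f|.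
Proof.
apply: opnorm_le => [|a]; first exact: mulr_ge0.
by rewrite (le_trans (le_blin_norm n _))// -mulrA ler_wpM2l// dualr_norm.
Qed.

Lemma rarens_act_norm n f : `|rarens_act n f| <= `|n| * `|f|.
Proof.
apply: opnorm_le => [|a]; first exact: mulr_ge0.
by rewrite (le_trans (le_blin_norm n _))// -mulrA ler_wpM2l// duall_norm.
Qed.

Section Product.
Variables m n : dual (dual A).

Let larens_linear : linear (fun f : dual A => m (larens_act n f) : K^o).
Proof.
move=> k f g; apply: etrans (linearP m k (larens_act n f) (larens_act n g)).
congr (m _); apply: blin_ext => a; apply: etrans (linearP n k _ _).
by congr (n _); apply: blin_ext.
Qed.

Let larens_bounded :
  exists2 M, 0 <= M & forall f, `|m (larens_act n f) : K^o| <= M * `|f|.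
Proof.
exists (`|m| * `|n|) => [|f]; first exact: mulr_ge0.
by rewrite (le_trans (le_blin_norm _ _))// -mulrA ler_wpM2l// larens_act_norm.
Qed.

(* <m . n, f> = <m, n . f> *)
Definition larens : dual (dual A) := mk_blin larens_linear larens_bounded.

Let rarens_linear : linear (fun f : dual A => n (rarens_act m f) : K^o).
Proof.
move=> k f g; apply: etrans (linearP n k (rarens_act m f) (rarens_act m g)).
congr (n _); apply: blin_ext => a; apply: etrans (linearP m k _ _).
by congr (m _); apply: blin_ext.
Qed.

Let rarens_bounded :
  exists2 M, 0 <= M & forall f, `|n (rarens_act m f) : K^o| <= M * `|f|.
Proof.
exists (`|n| * `|m|) => [|f]; first exact: mulr_ge0.
by rewrite (le_trans (le_blin_norm _ _))// -mulrA ler_wpM2l// rarens_act_norm.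
Qed.

(* <m # n, f> = <n, f # m> *)
Definition rarens : dual (dual A) := mk_blin rarens_linear rarens_bounded.

End Product.

End Arens.

(* Main.v *)
(** Write [B_i] for one of the ideals of condition (L), [p_i] for its projection
    and [(e_n)] for its sequential approximate identity.  For [b] in [B],
    [b e_n = p_i (b e_n) = p_i(b) e_n] converges to [p_i(b)], so right
    multiplications by the [e_n] are uniformly bounded, and since [B] has a BAI
    the sequence [(e_n)] is itself bounded.  A functional [g . a] restricts to
    some [h . b] on [B], hence converges along [(e_n)]; by boundedness every
    functional in the closed span of [A^* A], in particular every [mu^* f], is
    Cauchy along [(e_n)].  Thus [mu(e_n)] is weakly Cauchy in [B_i]; if [y] is its
    weak limit, [mu x = lim mu(e_n) x = y x] for [x] in [B_i].
    For (ii) => (iii), a functional [n] on [A^*] vanishing on [A^* A] satisfies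
    [n . f = 0] for all [f], hence [<n, mu^* f> = <m, n . f> = 0], and
    Hahn-Banach separation applies. *)

Require Import Defs.
From mathcomp Require Import all_boot all_order all_algebra.
From mathcomp Require Import complex.
From mathcomp Require Import boolp classical_sets functions reals topology.
From mathcomp Require Import interval_inference normedtype.
From mathcomp Require Import ring lra.
Import Order.TTheory GRing.Theory Num.Theory.
Import numFieldNormedType.Exports.
Local Open Scope classical_set_scope.
Local Open Scope ring_scope.
Set Implicit Arguments.
Unset Strict Implicit.
Unset Printing Implicit Defensive.

(** * The Hahn-Banach theorem *)

Section RealHahnBanach.
Variables (R : realType) (c : bool) (V : lmodType (scalars R c)).
Implicit Types (p q : V -> R) (D : set (V * R)).

(** Scalars pass through [sc_of c], so [V] is treated as a real vector space. For [t > 0] the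
    inequality in the second clause also gives the reverse one, by using it with [t^-1]. *)
Definition sublinear p : Prop :=
  (forall x y, p (x + y) <= p x + p y) /\
  (forall t x, 0 <= t -> p (sc_of c t *: x) <= t * p x).

(** A pair [(v, r)] in [D] stands for the constraint [r <= g v] on a functional [g] to be found; the
    cone axioms close such constraints under their linear consequences. *)
Definition convex_cone D : Prop :=
  [/\ D (0, 0),
      forall v w r s, D (v, r) -> D (w, s) -> D (v + w, r + s)
    & forall t v r, 0 <= t -> D (v, r) -> D (sc_of c t *: v, t * r)].

Lemma sublinear0 p : sublinear p -> p 0 = 0.
Proof.
move=> [pD pZ]; apply/eqP; rewrite eq_le; apply/andP; split.
  by have := pZ 0 0 (lexx 0); rewrite scaler0 mul0r.
by have := pD 0 0; rewrite addr0 -lerBlDr subrr.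
Qed.

Lemma sublinear_ge p x : sublinear p -> - p (- x) <= p x.
Proof.
move=> sp; rewrite lerNl -subr_ge0 opprK addrC -(sublinear0 sp) -(subrr x).
by case: sp => + _; exact.
Qed.

(* [q] is the infimal convolution [x |-> inf_{(v, r) in D} p (x + v) - r]. *)
Lemma sublinear_cone p D : sublinear p -> convex_cone D ->
  (forall v r, D (v, r) -> r <= p v) ->
  exists q, [/\ sublinear q, forall x, q x <= p x
             & forall v r, D (v, r) -> q (- v) <= - r].
Proof.
move=> sp [D0 DD DZ] Dp; have [pD pZ] := sp.
pose E x := [set p (x + u.1) - u.2 | u in D].
have hE x : has_inf (E x).
  split; first by exists (p (x + 0) - 0), (0, 0).
  exists (- p (- x)) => _ [[v r] Dvr <-] /=.
  have := Dp _ _ Dvr; have := pD (- x) (x + v); rewrite addKr; lra.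
have qle x v r : D (v, r) -> inf (E x) <= p (x + v) - r.
  by move=> Dvr; apply: ge_inf; [case: (hE x)|exists (v, r)].
have leq x s : (forall v r, D (v, r) -> s <= p (x + v) - r) -> s <= inf (E x).
  move=> H; apply: lb_le_inf; first by case: (hE x).
  by move=> _ [[v r] Dvr <-]; exact: H.
exists (fun x => inf (E x)); split => [|x|v r Dvr].
- split=> [x y|t x] /=.
    rewrite -lerBlDr; apply: (leq) => v r Dvr; rewrite lerBlDr -lerBlDl.
    apply: (leq) => w s Dws; have := qle (x + y) _ _ (DD _ _ _ _ Dvr Dws).
    have := pD (x + v) (y + w); rewrite addrACA; lra.
  rewrite le_eqVlt => /predU1P[<-|t0].
    rewrite sc_of0 scale0r mul0r; apply: le_trans (qle _ _ _ D0) _.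
    by rewrite addr0 subr0 (sublinear0 sp).
  rewrite -ler_pdivrMl//; apply: (leq) => v r Dvr; rewrite ler_pdivrMl//.
  have := qle (sc_of c t *: x) _ _ (DZ _ _ _ (ltW t0) Dvr).
  have := pZ t (x + v) (ltW t0); rewrite scalerDr; lra.
- by have := qle x _ _ D0; rewrite addr0 subr0.
- by have := qle (- v) _ _ Dvr; rewrite addNr (sublinear0 sp) sub0r.
Qed.

(** Zorn's lemma: the pointwise infimum over a chain is again sublinear, and [- p (- x)] bounds all
    values at [x] from below, so the infimum is finite. *)
Lemma minimal_sublinear p : sublinear p -> exists q,
  [/\ sublinear q, forall x, q x <= p x
    & forall r, sublinear r -> (forall x, r x <= q x) -> r = q].
Proof.
move=> sp.
pose T := {q : V -> R | sublinear q /\ forall x, q x <= p x}.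
pose below (q r : T) := `[< forall x, sval r x <= sval q x >].
have [| | | |[q [sq qp]] qmin] := @Zorn T below.
- by move=> q; apply/asboolP.
- move=> q r s /asboolP qr /asboolP rs; apply/asboolP => x.
  exact: le_trans (rs x) (qr x).
- move=> [q Hq] [r Hr] /asboolP /= qr /asboolP /= rq; apply: eq_exist.
  by apply/funext => x; apply/eqP; rewrite eq_le qr rq.
- move=> A totA; have [->|/set0P[a Aa]] := eqVneq A set0.
    by exists (exist _ p (conj sp (fun x => lexx (p x)))).
  pose E x := [set sval q x | q in A].
  have hE x : has_inf (E x).
    split; first by exists (sval a x), a.
    exists (- p (- x)) => _ [[q [sq qp]] Aq <-] /=.
    by have := sublinear_ge x sq; have := qp (- x); lra.
  have leE (q : T) x : A q -> inf (E x) <= sval q x.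
    by move=> Aq; apply: ge_inf; [case: (hE x)|exists q].
  have geE x s : (forall q : T, A q -> s <= sval q x) -> s <= inf (E x).
    move=> H; apply: lb_le_inf; first by case: (hE x).
    by move=> _ [q Aq <-]; exact: H.
  have sE : sublinear (fun x => inf (E x)).
    split=> [x y|t x t0] /=.
      rewrite -lerBlDr; apply: (geE) => q Aq; rewrite lerBlDr -lerBlDl.
      apply: (geE) => r Ar; rewrite lerBlDl.
      (* Subadditivity mixes two members of the chain; the smaller of the two bounds the infimum at
         [x + y]. *)
      have [/asboolP qr|/asboolP rq] := totA _ _ Aq Ar.
        have := leE _ (x + y) Ar; have := (svalP r).1.1 x y; have := qr x; lra.
      have := leE _ (x + y) Aq; have := (svalP q).1.1 x y; have := rq y; lra.
    move: t0; rewrite le_eqVlt => /predU1P[<-|t0].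
      rewrite sc_of0 scale0r mul0r; apply: le_trans (leE _ _ Aa) _.
      by rewrite (sublinear0 (svalP a).1).
    rewrite -ler_pdivrMl//; apply: (geE) => q Aq; rewrite ler_pdivrMl//.
    exact: le_trans (leE _ _ Aq) ((svalP q).1.2 _ _ (ltW t0)).
  have Ep x : inf (E x) <= p x := le_trans (leE _ _ Aa) ((svalP a).2 x).
  exists (exist _ (fun x => inf (E x)) (conj sE Ep)) => q Aq.
  by apply/asboolP => x; exact: leE.
exists q; split=> // r sr rq.
have rp : forall x, r x <= p x by move=> x; exact: le_trans (rq x) (qp x).
by have /(congr1 sval) := qmin (exist _ r (conj sr rp)) (introT (asboolP _) rq).
Qed.

(* A minimal sublinear functional [g] is linear: for fixed [y], [sublinear_cone]
   applied to the ray through [(y, g y)] does not lower [g], so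
   [g (- y) <= - g y]. *)
Lemma mazur_orlicz p D : sublinear p -> convex_cone D ->
  (forall v r, D (v, r) -> r <= p v) ->
  exists g : V -> R, [/\ {morph g : x y / x + y},
    forall t x, g (sc_of c t *: x) = t * g x,
    forall x, g x <= p x & forall v r, D (v, r) -> r <= g v].
Proof.
move=> sp cD Dp; have [q [sq qp qD]] := sublinear_cone sp cD Dp.
have [g [sg gq gmin]] := minimal_sublinear sq.
have gN y : g (- y) = - g y.
  apply/eqP; rewrite eq_le; apply/andP; split; last first.
    by rewrite lerNl sublinear_ge.
  pose Dy := [set u | exists2 t, 0 <= t & u = (sc_of c t *: y, t * g y)].
  have cDy : convex_cone Dy.
    split; first by exists 0; rewrite // sc_of0 scale0r mul0r.
      move=> _ _ _ _ [t t0 [-> ->]] [s s0 [-> ->]].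
      by exists (t + s); rewrite ?addr_ge0// sc_ofD scalerDl mulrDl.
    move=> t _ _ t0 [s s0 [-> ->]].
    by exists (t * s); rewrite ?mulr_ge0// sc_ofM scalerA mulrA.
  have Dyg v r : Dy (v, r) -> r <= g v.
    move=> [t]; rewrite le_eqVlt => /predU1P[<-|t0] [-> ->].
      by rewrite sc_of0 scale0r mul0r (sublinear0 sg).
    rewrite -ler_pdivlMl//.
    have := sg.2 t^-1 (sc_of c t *: y).
    by rewrite scalerA -sc_ofM mulVf ?gt_eqF// sc_of1 scale1r invr_ge0 ltW//; apply.
  have [h [sh hg hD]] := sublinear_cone sg cDy Dyg.
  rewrite -{1}(gmin _ sh hg); apply: hD; exists 1 => //.
  by rewrite sc_of1 scale1r mul1r.
have gD : {morph g : x y / x + y}.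
  move=> x y; apply/eqP; rewrite eq_le sg.1 /=.
  by have := sg.1 (x + y) (- y); rewrite addrK gN; lra.
have gZ t x : 0 <= t -> g (sc_of c t *: x) = t * g x.
  move=> t0; apply/eqP; rewrite eq_le sg.2//=.
  by have := sg.2 t (- x) t0; rewrite scalerN !gN mulrN lerN2.
exists g; split=> //.
- move=> t x; have [/gZ//|/ltW t0] := leP 0 t.
  have tN : sc_of c t = - sc_of c (- t).
    by apply/eqP; rewrite -addr_eq0 -sc_ofD subrr sc_of0.
  by rewrite tN scaleNr gN gZ ?oppr_ge0// mulNr opprK.
- by move=> x; exact: le_trans (gq x) (qp x).
- by move=> v r /qD; have := gq (- v); rewrite gN; lra.
Qed.

End RealHahnBanach.

(** * Real parts of scalars *)

Section ScalarsExtra.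
Variables (R : realType) (c : bool).
Local Notation K := (scalars R c).

Lemma sc_of_gt0 (t : R) : (0 < sc_of c t) = (0 < t).
Proof. by case: c => //=; rewrite ltcR. Qed.

Lemma sc_reD (k l : K) : sc_re (k + l) = sc_re k + sc_re l.
Proof. by case: c k l => //= -[a b] [a' b']. Qed.

Lemma sc_reZ (t : R) (k : K) : sc_re (sc_of c t * k) = t * sc_re k.
Proof. by case: c k => //= -[a b] /=; rewrite mul0r subr0. Qed.

Lemma sc_re_le (k : K) : sc_of c (sc_re k) <= `|k|.
Proof.
case: c k => /=; last exact: ler_norm.
move=> [a b]; rewrite normc_def lecR /= (le_trans (ler_norm a))//.
by rewrite -sqrtr_sqr ler_wsqrtr// lerDl sqr_ge0.
Qed.

(** In the complex case [z = 1] recovers the real part and [z = i] the imaginary part. *)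
Lemma sc_re_mul_inj (k l : K) :
  (forall z : K, sc_re (z * k) = sc_re (z * l)) -> k = l.
Proof.
case: c k l => /= [|k l /(_ 1)]; last by rewrite !mul1r.
move=> [a b] [a' b'] H; have := H 1; have := H ('i)%C.
by rewrite !mul1r /= !mul0r !sub0r !mul1r => /oppr_inj -> ->.
Qed.

Lemma sc_of_norm (t : R) : `|sc_of c t| = sc_of c `|t|.
Proof. by case: c => //=; rewrite normc_def /= expr0n addr0 sqrtr_sqr. Qed.

Lemma sc_re0 : sc_re (0 : K) = 0.
Proof. by case: c. Qed.

Lemma sc_reN (k : K) : sc_re (- k) = - sc_re k.
Proof. by apply/eqP; rewrite -addr_eq0 -sc_reD addNr sc_re0. Qed.

End ScalarsExtra.

(* The complex functional with real part [g] is [x |-> g x - i g (i x)]. *)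
Lemma real_part_functional (R : realType) (c : bool)
    (V : normedModType (scalars R c)) (g : V -> R) (M : scalars R c) :
  0 <= M -> {morph g : x y / x + y} ->
  (forall t x, g (sc_of c t *: x) = t * g x) ->
  (forall x, sc_of c (g x) <= M * `|x|) ->
  exists F : dual V, forall x, sc_re (F x) = g x.
Proof.
move=> M0 gD gZ gM.
have g0 : g 0 = 0 by rewrite -(scale0r 0) -(sc_of0 R c) gZ mul0r.
have gN x : sc_of c `|g x| <= M * `|x|.
  have [_|_] := ger0P (g x); first exact: gM.
  have -> : - g x = g (- x).
    by apply/esym/eqP; rewrite -addr_eq0 -gD addNr g0.
  by rewrite -(normrN x); exact: gM.
case: c V g M M0 gD gZ gN {gM g0} => V g M M0 gD gZ gN; last first.
  have lg : linear (g : V -> (scalars R false)^o).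
    by move=> t x y; rewrite gD; congr (_ + _); exact: gZ.
  by exists (mk_blin lg (ex_intro2 _ _ M M0 gN)).
pose F x : R[i] := (g x +i* - g ('i%C *: x))%C.
have gC (a b : R) x : g ((a +i* b)%C *: x) = a * g x + b * g ('i%C *: x).
  rewrite -gZ -gZ -gD scalerA -scalerDl; congr (g (_ *: _)).
  by rewrite /=; simpc.
have lF : linear (F : V -> (scalars R true)^o).
  move=> [a b] x y; rewrite /F scalerDr !gD !scalerA.
  rewrite [('i * _)%C](_ : _ = (- b +i* a)%C); last by simpc.
  rewrite (gC a b) (gC (- b) a); apply/eqP; rewrite eq_complex /=.
  by apply/andP; split; apply/eqP; ring.
have gC_le x : `|(g x)%:C%C| <= M * `|x|.
  by have := gN x; rewrite -sc_of_norm.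
have norm_i : `|'i%C : R[i]| = 1.
  by rewrite normc_def /= expr0n expr1n add0r sqrtr1.
have bF : exists2 M : scalars R true,
    0 <= M & forall x, `|F x : (scalars R true)^o| <= M * `|x|.
  exists (M + M) => [|x]; first exact: addr_ge0.
  have -> : F x = (g x)%:C%C - 'i%C * (g ('i%C *: x))%:C%C by rewrite /F; simpc.
  rewrite (le_trans (ler_normB _ _))// mulrDl lerD ?gC_le//.
  rewrite normrM norm_i mul1r (le_trans (gC_le ('i%C *: x)))//.
  by rewrite normrZ norm_i mul1r.
by exists (mk_blin lF bF).
Qed.

Section HahnBanach.
Variables (R : realType) (c : bool).
Local Notation K := (scalars R c).

(** Both extension and separation are obtained from this form by a choice of [D]; the dominating
    sublinear functional is [M] times the norm, which also makes [F] continuous. *)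
Lemma hahn_banach_cone (V : normedModType K) (D : set (V * R)) (M : K) :
  0 <= M -> convex_cone D ->
  (forall v r, D (v, r) -> sc_of c r <= M * `|v|) ->
  exists F : dual V, forall v r, D (v, r) -> r <= sc_re (F v).
Proof.
move=> M0 cD DM; pose p (x : V) := sc_re (M * `|x|).
have pE x : sc_of c (p x) = M * `|x| by rewrite sc_reK// mulr_ge0.
have sp : sublinear p.
  split=> [x y|t x t0]; rewrite -(sc_of_le c).
    by rewrite sc_ofD !pE -mulrDr ler_wpM2l// ler_normD.
  by rewrite sc_ofM !pE normrZ sc_of_norm ger0_norm// mulrCA.
have Dp v r : D (v, r) -> r <= p v by move=> Dvr; rewrite -(sc_of_le c) pE DM.
have [g [gD gZ gp Dg]] := mazur_orlicz sp cD Dp.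
have [|F FE] := real_part_functional M0 gD gZ.
  by move=> x; rewrite -pE sc_of_le.
by exists F => v r; rewrite FE; exact: Dg.
Qed.

(** The constraints [sc_re (f x) <= sc_re (F (j x))] hold for [x] and [- x], hence are equalities;
    real parts on all multiples of [x] then determine the value. *)
Lemma functional_extension (X Y : normedModType K) (j : blin X Y) :
  (forall x, `|j x| = `|x|) ->
  forall f : dual X, exists F : dual Y, comp_blin F j = f.
Proof.
move=> jnorm f.
pose D := [set u : Y * R | exists x, u = (j x, sc_re (f x))].
have cD : convex_cone D.
  split; first by exists 0; rewrite !linear0 sc_re0.
  - by move=> _ _ _ _ [x [-> ->]] [y [-> ->]]; exists (x + y); rewrite !linearD sc_reD.
  - by move=> t _ _ _ [x [-> ->]]; exists (sc_of c t *: x); rewrite !linearZ sc_reZ.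
have [|F HF] := hahn_banach_cone (normr_ge0 f) cD.
  move=> _ _ [x [-> ->]]; rewrite jnorm (le_trans (sc_re_le _))//.
  exact: le_blin_norm.
have re_le x : sc_re (f x) <= sc_re (F (j x)) by apply: HF; exists x.
have reE x : sc_re (F (j x)) = sc_re (f x).
  apply/eqP; rewrite eq_le re_le andbT.
  by have := re_le (- x); rewrite !linearN !sc_reN lerN2.
exists F; apply: blin_ext => x; apply: sc_re_mul_inj => z.
have -> : z * comp_blin F j x = F (j (z *: x)) by rewrite !linearZ.
by rewrite reE linearZ.
Qed.

(* If [e > 0] bounds the distance from [x] to [W] from below, then [t e] is at
   most the norm of [w + t x] for [w] in [W] and [t >= 0]. *)
Lemma functional_separation (X : normedModType K) (W : set X) (x : X) :
  W 0 -> (forall k v w, W v -> W w -> W (k *: v + w)) -> ~ closure W x ->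
  exists F : dual X, (forall w, W w -> F w = 0) /\ F x <> 0.
Proof.
move=> W0 WD nWx.
have [e e0 We] : exists2 e : R, 0 < e & forall w, W w -> sc_of c e <= `|w + x|.
  apply: contrapT => H; apply: nWx => B /nbhs_ballP[e /= e0 eB].
  apply: contrapT => WB; apply: H; exists (sc_re e).
    by rewrite -(sc_of_gt0 c) sc_reK// ltW.
  move=> w Ww; rewrite (sc_reK (ltW e0)).
  rewrite real_leNgt; [|exact: gtr0_real|exact: normr_real]; apply/negP => wx.
  apply: WB; exists (- w); split.
    by rewrite -[- w]addr0 -scaleN1r; exact: WD.
  by apply: eB; rewrite -ball_normE /= opprK addrC.
pose D := [set u : X * R |
  exists w t, [/\ W w, 0 <= t & u = (w + sc_of c t *: x, t * e)]].
have cD : convex_cone D.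
  split.
  - by exists 0, 0; rewrite sc_of0 scale0r mul0r addr0.
  - move=> _ _ _ _ [v [s [Wv s0 [-> ->]]]] [w [t [Ww t0 [-> ->]]]].
    exists (v + w), (s + t); split; rewrite ?addr_ge0//.
      by rewrite -[v]scale1r; exact: WD.
    by rewrite sc_ofD scalerDl mulrDl addrACA.
  - move=> t _ _ t0 [w [s [Ww s0 [-> ->]]]].
    exists (sc_of c t *: w), (t * s); split; rewrite ?mulr_ge0//.
      by rewrite -[_ *: w]addr0; exact: WD.
    by rewrite scalerDr scalerA sc_ofM mulrA.
have [|F HF] := hahn_banach_cone (ler01 : 0 <= 1 :> K) cD.
  move=> _ _ [w [t [Ww + [-> ->]]]]; rewrite mul1r.
  rewrite le_eqVlt => /predU1P[<-|t0]; first by rewrite mul0r sc_of0.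
  have t0' : 0 < sc_of c t by rewrite sc_of_gt0.
  rewrite sc_ofM -ler_pdivlMl//.
  have -> : (sc_of c t)^-1 * `|w + sc_of c t *: x| = `|(sc_of c t)^-1 *: w + x|.
    rewrite -[X in X * _]ger0_norm ?invr_ge0 ?ltW// -normrZ scalerDr scalerA.
    by rewrite mulVf ?gt_eqF// scale1r.
  by apply: We; rewrite -[_ *: w]addr0; exact: WD.
exists F; split=> [w Ww|Fx0].
  apply: sc_re_mul_inj => z; rewrite mulr0.
  (* The pair [(k *: w, 0)] lies in [D] for every scalar [k]; [k = z] and [k = - z] together make
     the real part of [z * F w] vanish. *)
  have H k : 0 <= sc_re (F (k *: w)).
    apply: HF; exists (k *: w), 0; rewrite sc_of0 scale0r addr0 mul0r; split=> //.
    by rewrite -[_ *: w]addr0; exact: WD.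
  apply/eqP; rewrite sc_re0 eq_le; apply/andP; split; last first.
    by have := H z; rewrite linearZ.
  by have := H (- z); rewrite scaleNr linearN linearZ sc_reN oppr_ge0.
have : e <= sc_re (F x).
  by apply: HF; exists 0, 1; rewrite sc_of1 scale1r add0r mul1r.
by rewrite Fx0 leNgt sc_re0 e0.
Qed.

(** A nonzero [x - y] is separated from the closed subspace [[set 0]]. *)
Lemma functional_inj (X : normedModType K) (x y : X) :
  (forall f : dual X, f x = f y) -> x = y.
Proof.
move=> fxy; apply/eqP; rewrite -subr_eq0; apply: contrapT => xy.
have [| | |F [_]] := @functional_separation X [set 0] (x - y).
- by [].
- by move=> k _ _ -> ->; rewrite scaler0 addr0.
- have z0 : 0 < `|x - y| by rewrite normr_gt0; exact/negP.
  move=> /(_ (ball (x - y) `|x - y|)) /(_ (nbhsx_ballx _ _ z0)) [_ [->]].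
  by rewrite -ball_normE /= subr0 ltxx.
- by apply; apply: etrans (linearB F x y) _; apply/eqP; rewrite subr_eq0; exact/eqP/fxy.
Qed.

End HahnBanach.

(** * Uniform boundedness *)

Section UniformBoundedness.
Variables (R : realType) (c : bool).
Local Notation K := (scalars R c).

Lemma norm_cvg_le (X : normedModType K) (I : Type) (F : set_system I)
    (FF : ProperFilter F) (u : I -> X) (x y : X) (M : K) :
  u i @[i --> F] --> x -> (\forall i \near F, `|u i - y| <= M) -> `|x - y| <= M.
Proof.
move=> /cvgrPdist_lt ux uM; apply/ler_addgt0Pr => e e0.
have [i [xi iM]] := filter_ex (filterI (ux e e0) uM).
by rewrite (le_trans (ler_distD (u i) _ _))// addrC lerD// ltW.
Qed.

(* Real valued, so that norms are totally ordered even over the complex field. *)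
Definition rnorm (X : normedModType K) (x : X) : R := sc_re `|x|.

Lemma rnormE (X : normedModType K) (x : X) : sc_of c (rnorm x) = `|x|.
Proof. exact: sc_reK. Qed.

Lemma rnorm_ge0 (X : normedModType K) (x : X) : 0 <= rnorm x.
Proof. by rewrite -(sc_of_le c) rnormE sc_of0. Qed.

Lemma rnormD (X : normedModType K) (x y : X) : rnorm (x + y) <= rnorm x + rnorm y.
Proof. by rewrite -(sc_of_le c) sc_ofD !rnormE ler_normD. Qed.

Lemma rnormN (X : normedModType K) (x : X) : rnorm (- x) = rnorm x.
Proof. by rewrite /rnorm normrN. Qed.

Lemma rnormZ (X : normedModType K) t (x : X) :
  rnorm (sc_of c t *: x) = `|t| * rnorm x.
Proof. by rewrite /rnorm normrZ sc_of_norm sc_reZ. Qed.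

Lemma rnorm_blin (X Y : normedModType K) (T : blin X Y) x :
  rnorm (T x) <= rnorm T * rnorm x.
Proof. by rewrite -(sc_of_le c) sc_ofM !rnormE le_blin_norm. Qed.

Lemma rnorm_le (X Y : normedModType K) (T : blin X Y) M : 0 <= M ->
  (forall x, rnorm (T x) <= M * rnorm x) -> rnorm T <= M.
Proof.
move=> M0 TM; rewrite -(sc_of_le c) rnormE; apply: opnorm_le.
  by rewrite -(sc_of0 R c) sc_of_le.
by move=> x; rewrite -!rnormE -sc_ofM sc_of_le.
Qed.

(** Rescale [y] to a vector [z] of norm [r]; then [T z = T (x + z) - T x] is a difference of two
    values on the ball, whence [M + M]. *)
Lemma bounded_on_ball (X Y : normedModType K) (T : blin X Y) x r M :
  0 < r -> (forall y, rnorm (y - x) <= r -> rnorm (T y) <= M) ->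
  rnorm T <= (M + M) / r.
Proof.
move=> r0 TM.
have M0 : 0 <= M.
  apply: le_trans (rnorm_ge0 (T x)) (TM x _).
  by rewrite subrr /rnorm normr0 sc_re0 ltW.
apply: rnorm_le => [|y]; first by rewrite divr_ge0 ?addr_ge0// ltW.
have [y0|y0] := eqVneq (rnorm y) 0.
  by have := rnorm_blin T y; rewrite y0 !mulr0.
have {}y0 : 0 < rnorm y by rewrite lt_neqAle eq_sym y0 rnorm_ge0.
have q0 : 0 <= r / rnorm y by rewrite divr_ge0// ltW.
pose z := sc_of c (r / rnorm y) *: y.
have Tz : rnorm (T z) <= M + M.
  have -> : T z = T (x + z) - T x by rewrite -linearB addrC addKr.
  rewrite (le_trans (rnormD _ _))// rnormN lerD//; apply: TM.
    by rewrite addrC addKr rnormZ ger0_norm// divfK ?gt_eqF.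
  by rewrite subrr /rnorm normr0 sc_re0 ltW.
move: Tz; rewrite linearZ rnormZ ger0_norm//.
by rewrite mulrAC ler_pdivrMr// mulrAC ler_pdivlMr// mulrC.
Qed.

(* Baire's theorem in disguise: if the norms of the [T n] are unbounded, there
   are nested balls such that some [T n] is at least [k] on the [k]-th one. *)
Lemma uniform_boundedness (X : completeNormedModType K) (Y : normedModType K)
    (T : nat -> blin X Y) :
  (forall x, exists M : R, forall n, rnorm (T n x) <= M) ->
  exists M : R, forall n, rnorm (T n) <= M.
Proof.
move=> Tx; apply: contrapT => unbounded.
have step (u : nat * (X * R)) : exists v : X * R, 0 < u.2.2 <= 1 ->
    [/\ 0 < v.2 <= u.2.2 / 2, rnorm (v.1 - u.2.1) <= u.2.2 / 2
      & exists n, forall y, rnorm (y - v.1) <= v.2 -> u.1%:R <= rnorm (T n y)].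
  case: u => k [x r] /=.
  (* The choice function must be total; for radii outside the range nothing is claimed and [(x, r)]
     is a default. *)
  have [/andP[r0 r1]|] := boolP (0 < r <= 1); last by exists (x, r).
  (* Otherwise all [T n] would be bounded by [k + 1] on one ball of radius [r / 2], hence bounded in
     norm. *)
  have [n [y [yr Ty]]] : exists n y,
      rnorm (y - x) <= r / 2 /\ k%:R + 1 <= rnorm (T n y).
    apply: contrapT => H; apply: unbounded.
    exists ((k%:R + 1 + (k%:R + 1)) / (r / 2)) => n.
    apply: (@bounded_on_ball _ _ _ x); first by rewrite divr_gt0.
    move=> y yx; rewrite leNgt; apply/negP => ky; apply: H.
    by exists n, y; split=> //; exact: ltW.
  have Tn0 : 0 < rnorm (T n) + 1 by rewrite ltr_wpDl ?rnorm_ge0.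
  (* On a ball of this radius [T n] varies by at most [r / 2 <= 1], so its norm drops from [k + 1]
     to no less than [k]. *)
  exists (y, r / 2 / (rnorm (T n) + 1)) => _ /=; split => //.
    rewrite !divr_gt0//= ler_pdivrMr// ler_peMr ?divr_ge0 ?(ltW r0)//.
    by rewrite lerDr rnorm_ge0.
  exists n => z; rewrite ler_pdivlMr// => zy.
  have : rnorm (T n y) <= rnorm (T n z) + rnorm (T n (z - y)).
    have -> : T n y = T n z + - T n (z - y) by rewrite linearB subKr.
    by rewrite -[rnorm (T n (z - y))]rnormN rnormD.
  have := rnorm_blin (T n) (z - y); have := rnorm_ge0 (z - y); nra.
have [g gP] := choice step.
pose s n := iteri n (fun k u => g (k, u)) (0, 1).
have s01 n : 0 < (s n).2 <= 1.
  elim: n => [|n IHn] /=; first by rewrite ltr01 lexx.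
  have /andP[_ s1] := IHn.
  have [/andP[-> /=]] := gP (n, s n) IHn; move=> /le_trans + _ _; apply.
  by rewrite ler_pdivrMr// mul1r (le_trans s1)// ler1n.
have sP n : [/\ 0 < (s n.+1).2 <= (s n).2 / 2,
    rnorm ((s n.+1).1 - (s n).1) <= (s n).2 / 2
  & exists m, forall y, rnorm (y - (s n.+1).1) <= (s n.+1).2 ->
      n%:R <= rnorm (T m y)] := gP (n, s n) (s01 n).
(* Nesting of the closed balls: each step moves the centre by at most half the radius and leaves at
   most half of it. *)
have s_nest n d : rnorm ((s (n + d)%N).1 - (s n).1) <= (s n).2 - (s (n + d)%N).2.
  elim: d => [|d IHd]; first by rewrite addn0 !subrr /rnorm normr0 sc_re0.
  have [/andP[_ s1] s2 _] := sP (n + d)%N; rewrite addnS.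
  have := rnormD ((s (n + d).+1).1 - (s (n + d)%N).1) ((s (n + d)%N).1 - (s n).1).
  rewrite addrA subrK; lra.
have s_small n : (s n).2 <= n.+1%:R^-1.
  elim: n => [|n IHn]; first by rewrite invr1.
  have [/andP[_ /le_trans]] := sP n; move=> + _ _; apply.
  rewrite ler_pdivrMr// (le_trans IHn)// -[leLHS]mul1r ler_pdivrMr//.
  rewrite -mulrA ler_pdivlMl// mulr1 -natrM ler_nat.
  by rewrite mul2n -addnn addSn addnS !ltnS leq_addr.
have s_cauchy : cauchy ((s n).1 @[n --> \oo]).
  apply: cauchy_exP => e e0.
  have e0' : 0 < sc_re e by rewrite -(sc_of_gt0 c) sc_reK// ltW.
  have [n _ /(_ n (leqnn n)) /= ne] := near_infty_natSinv_lt (PosNum e0').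
  exists (s n).1; exists n => //= m nm; rewrite -ball_normE /= distrC.
  rewrite -rnormE -(sc_reK (ltW e0)) -subr_gt0.
  have -> (a b : R) : sc_of c a - sc_of c b = sc_of c (a - b).
    by apply/eqP; rewrite subr_eq -sc_ofD subrK.
  rewrite sc_of_gt0 subr_gt0 (le_lt_trans _ ne)// (le_trans _ (s_small n))//.
  have := s_nest n (m - n)%N; rewrite subnKC//.
  by have /andP[] := s01 m; lra.
have [x sx] : exists x : X, (s n).1 @[n --> \oo] --> x.
  apply/cvg_ex; exact/cauchy_cvgP.
have xs n : rnorm (x - (s n).1) <= (s n).2.
  rewrite -(sc_of_le c) rnormE; apply: (norm_cvg_le _ sx).
  exists n => // m /= nm; rewrite -rnormE sc_of_le.
  have := s_nest n (m - n)%N; rewrite subnKC//.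
  by have /andP[] := s01 m; lra.
(* The limit [x] lies in every ball, so the values at [x] exceed any proposed bound [M]. *)
have [M TM] := Tx x.
have [n _ /(_ n (leqnn n))/= Mn] := nbhs_infty_gtr M.
have [_ _ [m /(_ x (xs n.+1))]] := sP n.
by rewrite leNgt (le_lt_trans (TM m)).
Qed.

End UniformBoundedness.

Lemma tails_proper (I : Type) (le : I -> I -> Prop) :
  directed le -> ProperFilter (tails le).
Proof.
move=> [[i0] lexx le_trans le_dir]; apply: filter_from_proper.
  apply: filter_from_filter; first by exists i0.
  move=> i j _ _; have [k ik jk] := le_dir i j; exists k => // l /= kl.
  by split; [exact: le_trans kl|exact: le_trans kl].
by move=> i _; exists i.
Qed.

(** * Weak limits of multipliers along an approximate identity *)

Section WeakCauchy.
Variables (R : realType) (c : bool).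
Local Notation K := (scalars R c).

Lemma cauchy_seqP (X : normedModType K) (u : nat -> X) :
  cauchy (u n @[n --> \oo]) <->
  forall e : K, 0 < e -> exists x, \forall n \near \oo, `|x - u n| < e.
Proof.
split=> [/cauchyP uC e e0|uC].
  by have [x xu] := uC e e0; exists x; move: xu; rewrite -ball_normE.
apply: cauchy_exP => e e0; have [x xu] := uC e e0; exists x.
by rewrite -ball_normE.
Qed.

(** The functionals that are Cauchy along [a] form a linear space, which is norm closed because [a]
    is bounded. *)
Lemma cauchy_closed_span (X : normedModType K) (S : set (dual X))
    (a : nat -> X) (M : K) :
  (forall n, `|a n| <= M) ->
  (forall s, S s -> cauchy (s (a n) @[n --> \oo])) ->
  forall g, closed_span S g -> cauchy (g (a n) @[n --> \oo]).
Proof.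
move=> aM Sa g Sg.
have M0 : 0 <= M by exact: le_trans (normr_ge0 _) (aM 0%N).
pose P (h : dual X) := cauchy (h (a n) @[n --> \oo]).
have PD h k : P h -> P k -> P (h + k).
  move=> /cauchy_seqP Ph /cauchy_seqP Pk; apply/cauchy_seqP => e e0.
  have e2 : 0 < e / 2 by rewrite divr_gt0.
  have [[x xh] [y yk]] := (Ph _ e2, Pk _ e2); exists (x + y).
  apply: filterS2 xh yk => n xn yn; rewrite blinDE opprD addrACA (splitr e).
  by rewrite (le_lt_trans (ler_normD _ _))// ltrD.
have PZ t h : P h -> P (t *: h).
  move=> /cauchy_seqP Ph; apply/cauchy_seqP => e e0.
  have t0 : 0 < `|t| + 1 by rewrite ltr_wpDl.
  have [x xh] := Ph _ (divr_gt0 e0 t0); exists (t * x).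
  apply: filterS xh => n; rewrite ltr_pdivlMr// => xn.
  rewrite blinZE -mulrBr normrM (le_lt_trans _ xn)// mulrC ler_wpM2l//.
  by rewrite lerDl.
have P0 : P 0.
  by apply/cauchy_seqP => e e0; exists 0; apply: nearW => n; rewrite subrr normr0.
apply/cauchy_seqP => e e0.
have e2 : 0 < e / 2 by rewrite divr_gt0.
(* [M] may be zero; [M + 1] is a safe divisor. *)
have M1 : 0 < M + 1 by rewrite ltr_wpDl.
have [_ [[n [k [s [Ss ->]]]]]] := Sg _ (nbhsx_ballx g _ (divr_gt0 e2 M1)).
set h := \sum_(i < n) _; rewrite -ball_normE /= => gh.
have : P h by apply: big_ind => // i _; apply: PZ; exact: Sa.
move=> /cauchy_seqP /(_ _ e2)[x xh]; exists x.
apply: filterS xh => m xm.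
rewrite (le_lt_trans (ler_distD (h (a m)) _ _))// (splitr e) ltrD//.
have -> : h (a m) - g (a m) = (h - g) (a m) by [].
rewrite (le_lt_trans (le_blin_norm _ _))//.
have {}gh : `|h - g| * (M + 1) < e / 2 by rewrite -ltr_pdivlMr// distrC.
apply: le_lt_trans gh; rewrite ler_wpM2l//.
by rewrite (le_trans (aM m))// lerDl.
Qed.

(** A tail stays within distance 1 of the limit; the sum covers the finitely many earlier terms. *)
Lemma cvg_rnorm_bounded (X : normedModType K) (u : nat -> X) (x : X) :
  u n @[n --> \oo] --> x -> exists M : R, forall n, rnorm (u n) <= M.
Proof.
move=> /cvgrPdist_lt /(_ _ ltr01) [N _ uN].
exists (rnorm x + 1 + \sum_(i < N) rnorm (u i)) => n.
have [/uN/= xn|nN] := leqP N n.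
  rewrite -[leLHS]addr0 lerD ?sumr_ge0// => [|i _]; last exact: rnorm_ge0.
  rewrite -(subKr x (u n)) (le_trans (rnormD _ _))// rnormN lerD//.
  by rewrite -(sc_of_le c) rnormE sc_of1 ltW.
rewrite (bigD1 (Ordinal nN))//= addrCA lerDl addr_ge0 ?addr_ge0 ?rnorm_ge0//.
by apply: sumr_ge0 => i _; exact: rnorm_ge0.
Qed.

(* [T y] stands for the right (resp. left) multiplication by [y], which lets the
   two versions of the theorem share this lemma and the next one. *)
Lemma weak_cauchy_adjoint (X : normedModType K) (Y : completeNormedModType K)
    (j : blin Y X) (T : Y -> blin Y Y) (N : K) (S : set (dual X))
    (mu : blin X X) (e : nat -> Y) :
  0 <= N -> (forall y, `|y| <= N * `|T y|) ->
  (forall b, exists y : Y, T (e n) b @[n --> \oo] --> y) ->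
  (forall s, S s -> exists (h : dual Y) b, forall y, s (j y) = h (T y b)) ->
  (forall f, closed_span S (adjoint mu f)) ->
  forall F : dual X, cauchy (F (mu (j (e n))) @[n --> \oo]).
Proof.
move=> N0 TN eT ST muS F.
have [M TM] : exists M : R, forall n, rnorm (T (e n)) <= M.
  by apply: uniform_boundedness => b; have [y /cvg_rnorm_bounded] := eT b.
apply: (@cauchy_closed_span _ _ (fun n => j (e n)) (`|j| * (N * sc_of c M))
  _ _ _ (muS F)).
  move=> n; rewrite (le_trans (le_blin_norm _ _))// ler_wpM2l//.
  by rewrite (le_trans (TN _))// ler_wpM2l// -rnormE sc_of_le.
move=> s /ST[h [b sE]].
have -> : (fun n => s (j (e n))) = (fun n => h (T (e n) b)).
  by apply/funext => n; rewrite sE.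
have [y Ty] := eT b; apply: cvg_cauchy; apply/cvg_ex; exists (h y).
exact: (continuous_cvg _ (@blin_continuous _ _ _ h y) Ty).
Qed.

(** Functionals on [Z] extend to [X], so [nu (e n)] is weakly Cauchy and has a weak limit [y]. The
    scalars [f (L x (nu (e n)))] tend to [f (L x y)] and, being equal to [f (nu (L x (e n)))], also
    to [f (nu x)]. *)
Lemma multiplier_weak_limit (X Z : normedModType K) (i : blin Z X)
    (L : Z -> blin Z Z) (mu : blin X X) (nu : blin Z Z) (e : nat -> Z) :
  weakly_sequentially_complete Z ->
  (forall z, `|i z| = `|z|) -> (forall z, i (nu z) = mu (i z)) ->
  (forall x z, nu (L x z) = L x (nu z)) ->
  (forall x, L x (e n) @[n --> \oo] --> x) ->
  (forall F : dual X, cauchy (F (mu (i (e n))) @[n --> \oo])) ->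
  exists y, forall x, nu x = L x y.
Proof.
move=> wscZ inorm inu nuL Le Fe.
have [|y ey] := wscZ (fun n => nu (e n)).
  move=> f; have [F <-] := functional_extension inorm f.
  have -> : (fun n => comp_blin F i (nu (e n))) = (fun n => F (mu (i (e n)))).
    by apply/funext => n; rewrite /= inu.
  exact: Fe.
exists y => x; apply: functional_inj => f.
have fL : f (L x (nu (e n))) @[n --> \oo] --> f (L x y).
  exact: (ey (comp_blin f (L x))).
have fnu : f (L x (nu (e n))) @[n --> \oo] --> f (nu x).
  have -> : (fun n => f (L x (nu (e n)))) = (fun n => comp_blin f nu (L x (e n))).
    by apply/funext => n; rewrite /= nuL.
  exact: (continuous_cvg _ (@blin_continuous _ _ _ (comp_blin f nu) x) (Le x)).
exact: (cvg_unique (@norm_hausdorff _ K^o) fnu fL).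
Qed.

End WeakCauchy.

(** * Consequences of a bounded approximate identity *)

Section BoundedApproximateIdentity.
Variables (R : realType) (c : bool) (A : banachAlgType (scalars R c)).
Local Notation K := (scalars R c).
Variable baiA : has_BAI A.

(** [x] is the limit of [rmul x (e i)], and [N] is a bound for the net [e]. This turns bounds on
    multiplication operators into bounds on elements. *)
Lemma norm_le_rmul : exists2 N : K, 0 <= N & forall x : A, `|x| <= N * `|rmul x|.
Proof.
have [I [le [e [dir [M eM] eA]]]] := baiA; have := tails_proper dir => FF.
have [[i0] _ _ _] := dir.
exists M => [|x]; first exact: le_trans (normr_ge0 _) (eM i0).
rewrite -[x in `|x|]subr0; apply: (norm_cvg_le _ (eA x).1).
apply: nearW => i; rewrite subr0 (le_trans (le_blin_norm (rmul x) (e i)))//.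
by rewrite mulrC ler_wpM2r.
Qed.

Lemma norm_le_lmul : exists2 N : K, 0 <= N & forall x : A, `|x| <= N * `|lmul x|.
Proof.
have [I [le [e [dir [M eM] eA]]]] := baiA; have := tails_proper dir => FF.
have [[i0] _ _ _] := dir.
exists M => [|x]; first exact: le_trans (normr_ge0 _) (eM i0).
rewrite -[x in `|x|]subr0; apply: (norm_cvg_le _ (eA x).2).
apply: nearW => i; rewrite subr0 (le_trans (le_blin_norm (lmul x) (e i)))//.
by rewrite mulrC ler_wpM2r.
Qed.

(** [nu x] is the limit of [nu (e i *b x) = nu (e i) *b x], and these lie in the closed ideal
    [C]. *)
Lemma LM_left_ideal (C : closedSubalg A) (nu : blin A A) :
  left_ideal C -> LM nu -> forall x, C x -> C (nu x).
Proof.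
have [I [le [e [dir _ eA]]]] := baiA; have := tails_proper dir => FF.
move=> idC LMnu x Cx.
have nux : nu (e i *b x) @[i --> tails le] --> nu x.
  exact: continuous_cvg (@blin_continuous _ _ _ nu x) (eA x).1.
apply: (@closed_cvg _ _ _ FF (fun i => nu (e i *b x)) _
  (@Defs.subalg_closed _ _ C) _ _ nux).
by apply: nearW => i; rewrite LMnu; exact: idC.
Qed.

Lemma RM_right_ideal (C : closedSubalg A) (nu : blin A A) :
  right_ideal C -> RM nu -> forall x, C x -> C (nu x).
Proof.
have [I [le [e [dir _ eA]]]] := baiA; have := tails_proper dir => FF.
move=> idC RMnu x Cx.
have nux : nu (x *b e i) @[i --> tails le] --> nu x.
  exact: continuous_cvg (@blin_continuous _ _ _ nu x) (eA x).2.
apply: (@closed_cvg _ _ _ FF (fun i => nu (x *b e i)) _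
  (@Defs.subalg_closed _ _ C) _ _ nux).
by apply: nearW => i; rewrite RMnu; exact: idC.
Qed.

End BoundedApproximateIdentity.

(** * Restriction of multipliers to invariant closed subalgebras *)

Section RestrictedOperator.
Variables (K : numFieldType) (A : banachAlgType K) (B : closedSubalg A).
Variables (mu : blin A A) (muB : forall x, B x -> B (mu x)).

Definition restr_fun (x : subalg B) : subalg B := Subalg (mem_set (muB (subalgP x))).

Let restr_linear : linear restr_fun.
Proof. by move=> k x y; apply: val_inj; exact: linearP. Qed.

Let restr_bounded : exists2 M, 0 <= M & forall x, `|restr_fun x| <= M * `|x|.
Proof. by have [M M0 H] := blin_bounded mu; exists M => // x; exact: H. Qed.

Definition restr : blin (subalg B) (subalg B) := mk_blin restr_linear restr_bounded.

Lemma restr_LM : LM mu -> LM restr.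
Proof. by move=> LMmu x y; apply: val_inj; exact: LMmu. Qed.

Lemma restr_RM : RM mu -> RM restr.
Proof. by move=> RMmu x y; apply: val_inj; exact: RMmu. Qed.

Lemma restr_is_lmul : is_lmul restr -> is_lmul_on B mu.
Proof.
move=> [b restrE]; exists (b : A) => [|x Bx]; first exact: subalgP.
exact: (congr1 (fun h : blin (subalg B) (subalg B) =>
  subalg_val (h (Subalg (mem_set Bx)))) restrE).
Qed.

Lemma restr_is_rmul : is_rmul restr -> is_rmul_on B mu.
Proof.
move=> [b restrE]; exists (b : A) => [|x Bx]; first exact: subalgP.
exact: (congr1 (fun h : blin (subalg B) (subalg B) =>
  subalg_val (h (Subalg (mem_set Bx)))) restrE).
Qed.

End RestrictedOperator.

(** * The implications between the three conditions *)

Section MainImplications.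
Variables (R : realType) (c : bool) (A : banachAlgType (scalars R c)).
Local Notation K := (scalars R c).
Variable mu : blin A A.

Let eval_linear (a : A) : linear (fun f : dual A => f a).
Proof. by []. Qed.

Let eval_bounded (a : A) :
  exists2 M : K, 0 <= M & forall f : dual A, `|f a| <= M * `|f|.
Proof. by exists `|a| => // f; rewrite mulrC; exact: le_blin_norm. Qed.

(** The canonical embedding of [A] into its bidual; it supplies the [m] of condition (ii). *)
Definition eval (a : A) : dual (dual A) :=
  mk_blin (@eval_linear a) (eval_bounded a).

Lemma larens_of_lmul : is_lmul mu ->
  exists m : dual (dual A), forall n, adjoint (adjoint mu) n = larens m n.
Proof. by move=> [a ->]; exists (eval a) => n; exact: blin_ext. Qed.

Lemma rarens_of_rmul : is_rmul mu ->
  exists m : dual (dual A), forall n, adjoint (adjoint mu) n = rarens n m.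
Proof. by move=> [a ->]; exists (eval a) => n; exact: blin_ext. Qed.

(** Contrapositive of Hahn-Banach separation, applied to the linear span of [S]. *)
Lemma closed_span_sep (S : set (dual A)) (g : dual A) :
  (forall n : dual (dual A), (forall s, S s -> n s = 0) -> n g = 0) ->
  closed_span S g.
Proof.
move=> H; apply: contrapT => Sg.
move: Sg; rewrite /closed_span; set W := [set x | _] => Sg.
have [| |n [nW ng]] := functional_separation _ _ Sg.
- by exists 0%N, (fun _ => 0), (fun _ => 0); split=> [[]|]//; rewrite big_ord0.
- move=> k _ _ [n [a [s [Ss ->]]]] [m [b [t [St ->]]]].
  exists (n + m)%N.
  (* Two linear combinations are concatenated, the first one scaled by [k]. *)
  exists (fun i => match fintype.split i with inl i => k * a i | inr i => b i end).
  exists (fun i => match fintype.split i with inl i => s i | inr i => t i end).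
  split=> [i|]; first by case: splitP.
  rewrite big_split_ord scaler_sumr /=; congr (_ + _); apply: eq_bigr => i _.
    by rewrite (unsplitK (inl i)) scalerA.
  by rewrite (unsplitK (inr i)).
apply: ng; apply: H => s Ss; apply: nW.
by exists 1%N, (fun _ => 1), (fun _ => s); split=> //; rewrite big_ord1 scale1r.
Qed.

Lemma span_of_larens (m : dual (dual A)) :
  (forall n, adjoint (adjoint mu) n = larens m n) ->
  forall f, closed_span (dualr_set A) (adjoint mu f).
Proof.
move=> mE f; apply: closed_span_sep => n nS.
have -> : n (adjoint mu f) = larens m n f by rewrite -mE.
have -> : larens m n f = m (larens_act n f) by [].
have -> : larens_act n f = 0 by apply: blin_ext => a; apply: nS; exists f, a.
by rewrite linear0.
Qed.

Lemma span_of_rarens (m : dual (dual A)) :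
  (forall n, adjoint (adjoint mu) n = rarens n m) ->
  forall f, closed_span (duall_set A) (adjoint mu f).
Proof.
move=> mE f; apply: closed_span_sep => n nS.
have -> : n (adjoint mu f) = rarens n m f by rewrite -mE.
have -> : rarens n m f = m (rarens_act n f) by [].
have -> : rarens_act n f = 0 by apply: blin_ext => a; apply: nS; exists a, f.
by rewrite linear0.
Qed.

(** Clause (III) reduces the claim to a single ideal [C i]. The weak limit is formed inside [C i],
    whereas [e] is bounded through its right multiplications on all of [subalg B], where the BAI
    lives. *)
Lemma LM_condition_L (B : closedSubalg A) (muB : forall x, B x -> B (mu x)) :
  LM mu -> condition_L (subalg B) ->
  (forall f, dualr_set A f -> dualr_set (subalg B) (dual_restr B f)) ->
  (forall f, closed_span (dualr_set A) (adjoint mu f)) -> is_lmul_on B mu.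
Proof.
move=> LMmu [baiB [I [C [idC wC projC inC]]]] SB muS.
apply: (@restr_is_lmul _ _ _ _ muB); have LMnu := restr_LM muB LMmu.
apply: inC => // i; set nu := restr muB in LMnu *.
have [wsc [e eC]] := wC i; have [p [[pC pid] pM]] := projC i.
have nuC := LM_left_ideal baiB (idC i) LMnu.
have [N N0 Ne] := norm_le_rmul baiB.
have [|||||y yE] := @multiplier_weak_limit _ _ A (subalg (C i))
  (comp_blin (Defs.incl B) (Defs.incl (C i))) (@rmul _ _) mu (restr nuC) e wsc.
- by [].
- by [].
- by move=> x z; exact: restr_LM.
- by move=> x; exact: (eC x).1.
- apply: (@weak_cauchy_adjoint _ _ A (subalg B) (Defs.incl B) (@rmul _ _) N
    (dualr_set A) mu (fun n => Defs.incl (C i) (e n)) N0 Ne) => //.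
  (* [b *b e n] lies in the left ideal, so [p] fixes it and the module property gives
     [p b *b e n]. *)
  + move=> b; exists (p b).
    have -> : (fun n => rmul (Defs.incl (C i) (e n)) b) =
        (fun n => Defs.incl (C i) (Subalg (mem_set (pC b)) *b e n)).
      apply/funext => n; rewrite /= -pM; last exact: subalgP.
      by rewrite pid//; apply: idC; exact: subalgP.
    have pb := (eC (Subalg (mem_set (pC b)))).2.
    exact: continuous_cvg (@blin_continuous _ _ _ (Defs.incl (C i)) _) pb.
  + move=> s /SB[h [b sE]]; exists h, b => z.
    exact: (congr1 (fun f : dual (subalg B) => f z) sE).
exists (Defs.incl (C i) y) => [|x Cx]; first exact: subalgP.
exact: (congr1 (fun z : subalg (C i) => subalg_val z) (yE (Subalg (mem_set Cx)))).
Qed.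

Lemma RM_condition_R (B : closedSubalg A) (muB : forall x, B x -> B (mu x)) :
  RM mu -> condition_R (subalg B) ->
  (forall f, duall_set A f -> duall_set (subalg B) (dual_restr B f)) ->
  (forall f, closed_span (duall_set A) (adjoint mu f)) -> is_rmul_on B mu.
Proof.
move=> RMmu [baiB [I [C [idC wC projC inC]]]] SB muS.
apply: (@restr_is_rmul _ _ _ _ muB); have RMnu := restr_RM muB RMmu.
apply: inC => // i; set nu := restr muB in RMnu *.
have [wsc [e eC]] := wC i; have [p [[pC pid] pM]] := projC i.
have nuC := RM_right_ideal baiB (idC i) RMnu.
have [N N0 Ne] := norm_le_lmul baiB.
have [|||||y yE] := @multiplier_weak_limit _ _ A (subalg (C i))
  (comp_blin (Defs.incl B) (Defs.incl (C i))) (@lmul _ _) mu (restr nuC) e wsc.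
- by [].
- by [].
- by move=> x z; exact: restr_RM.
- by move=> x; exact: (eC x).2.
- apply: (@weak_cauchy_adjoint _ _ A (subalg B) (Defs.incl B) (@lmul _ _) N
    (duall_set A) mu (fun n => Defs.incl (C i) (e n)) N0 Ne) => //.
  (* Mirror image: [e n *b b] lies in the right ideal and equals [e n *b p b]. *)
  + move=> b; exists (p b).
    have -> : (fun n => lmul (Defs.incl (C i) (e n)) b) =
        (fun n => Defs.incl (C i) (e n *b Subalg (mem_set (pC b)))).
      apply/funext => n; rewrite /= -pM; last exact: subalgP.
      by rewrite pid//; apply: idC; exact: subalgP.
    have pb := (eC (Subalg (mem_set (pC b)))).1.
    exact: continuous_cvg (@blin_continuous _ _ _ (Defs.incl (C i)) _) pb.
  + move=> s /SB[b [h sE]]; exists h, b => z.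
    exact: (congr1 (fun f : dual (subalg B) => f z) sE).
exists (Defs.incl (C i) y) => [|x Cx]; first exact: subalgP.
exact: (congr1 (fun z : subalg (C i) => subalg_val z) (yE (Subalg (mem_set Cx)))).
Qed.

End MainImplications.

Theorem theorem5 (R : realType) (c : bool) (A : banachAlgType (scalars R c))
    (baiA : has_BAI A) :
  ((forall mu : blin A A, LM mu ->
      exists B : closedSubalg A,
      [/\ condition_L (subalg B),
          forall f : dual A, dualr_set A f -> dualr_set (subalg B) (dual_restr B f),
          forall x : A, B x -> B (mu x)
        & is_lmul_on B mu -> is_lmul mu]) ->
   forall mu : blin A A, LM mu ->
   [<-> is_lmul mu;
        exists m : dual (dual A), forall n : dual (dual A),
          adjoint (adjoint mu) n = larens m n;
        forall f : dual A, closed_span (dualr_set A) (adjoint mu f)])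
  /\
  ((forall mu : blin A A, RM mu ->
      exists B : closedSubalg A,
      [/\ condition_R (subalg B),
          forall f : dual A, duall_set A f -> duall_set (subalg B) (dual_restr B f),
          forall x : A, B x -> B (mu x)
        & is_rmul_on B mu -> is_rmul mu]) ->
   forall mu : blin A A, RM mu ->
   [<-> is_rmul mu;
        exists m : dual (dual A), forall n : dual (dual A),
          adjoint (adjoint mu) n = rarens n m;
        forall f : dual A, closed_span (duall_set A) (adjoint mu f)]).
Proof.
(* Each version is the cycle (i) => (ii) => (iii) => (i); the subalgebra [B] serves to close the
   cycle. *)
split=> hyp mu Mmu; have [B [condB dualB muB in_A]] := hyp mu Mmu; tfae.
- exact: larens_of_lmul.
- by move=> [m mE]; exact: span_of_larens mE.
- by move=> muS; apply: in_A; exact: LM_condition_L muS.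
- exact: rarens_of_rmul.
- by move=> [m mE]; exact: span_of_rarens mE.
- by move=> muS; apply: in_A; exact: RM_condition_R muS.
Qed.
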